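(* Let $\mathcal{T}$ be a nonempty finite set of $3$-element subsets of a totally ordered set $X$, let $G=\Gamma_0(\mathcal{T})$ be its support graph, and let $n$ be a positive integer with $n \le \lceil \lambda(\mathcal{T}) \rceil$. Then: (a) every edge $e=\{x,y\}$ of $G$ is contained in at least $n-2$ members of $\mathcal{T}$; (b) for every edge $\{x,y\}$ of $G$, $|N_G(x)\cap N_G(y)| \ge n-2$; (c) for every vertex $x$ of $G$, at least $n-2$ members of $\mathcal{T}$ contain $x$, and $d_G(x)\ge n-1$; (d) $d_{\min}(G)\ge n-1$ and $|V(G)|\ge n$.
   Context: For a $3$-element subset $T=\{a,b,c\}\subseteq X$ with $a<b<c$ and a $2$-element subset $e$, the sign $[T:e]$ is $1$ if $e=\{a,b\}$ or $e=\{b,c\}$, $-1$ if $e=\{a,c\}$, and $0$ if $e\not\subset T$. The support graph $\Gamma_0(\mathcal{T})$ is the graph with vertex set $\bigcup_{T\in\mathcal T}T$ in which two distinct vertices are adjacent iff they lie in a common $T\in\mathcal T$. $\delta_{1,\mathcal T}$ is the $\mathcal T\times E(\Gamma_0(\mathcal T))$ matrix with entries $[T:e]$, and $\lambda(\mathcal T)$ is the smallest positive eigenvalue of $\delta_{1,\mathcal T}^T\delta_{1,\mathcal T}$ (equivalently of $\delta_{1,\mathcal T}\delta_{1,\mathcal T}^T$); it is independent of the total order on $X$. $N_G(x)$ is the neighborhood, $d_G(x)$ the degree, and $d_{\min}(G)$ the minimum degree. *)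

(* Defs.v *)
From HB Require Import structures.
From mathcomp Require Export all_boot all_order all_algebra.
From mathcomp Require Export finmap.
From mathcomp Require Export classical_sets reals.

Set Implicit Arguments.
Unset Strict Implicit.
Unset Printing Implicit Defensive.

Import Order.TTheory GRing.Theory Num.Theory.

Local Open Scope fset_scope.
Local Open Scope ring_scope.

(* Finite simple graphs whose vertices lie in a possibly infinite type X. *)
Record fsgraph (X : choiceType) := FSGraph {
  vertices : {fset X};
  adj : rel X;
  adj_irr : irreflexive adj;
  adj_sym : symmetric adj;
  adj_vertices : forall x y, adj x y -> x \in vertices
}.

Section Graph.
Variables (X : choiceType) (G : fsgraph X).

Definition edges : {fset {fset X}} :=
  [fset [fset x; y] | x in vertices G, y in vertices G & adj G x y].

Definition neighborhood (x : X) : {fset X} := [fset y in vertices G | adj G x y].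

Definition degree (x : X) : nat := #|` neighborhood x|.

(* Every degree is less than #|` vertices G|, so for a graph with at least one
   vertex the neutral element of the big operator does not affect the value. *)
Definition min_degree : nat :=
  \big[minn/#|` vertices G|]_(x <- vertices G) degree x.

End Graph.

Section SupportGraph.
Variables (X : choiceType) (T : {fset {fset X}}).

Definition support_vertices : {fset X} := \bigcup_(t <- T) t.

Definition support_adj : rel X :=
  fun x y => (x != y) && [exists t : T, (x \in val t) && (y \in val t)].

Lemma support_adj_irr : irreflexive support_adj.
Proof. by move=> x; rewrite /support_adj eqxx. Qed.

Lemma support_adj_sym : symmetric support_adj.
Proof.
move=> x y; rewrite /support_adj eq_sym; congr (_ && _).
by apply: eq_existsb => t; rewrite andbC.
Qed.

Lemma support_adj_vertices x y : support_adj x y -> x \in support_vertices.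
Proof.
case/andP=> _ /existsP[t /andP[xt _]].
by apply/bigfcupP; exists (val t) => //; rewrite andbT fsvalP.
Qed.

Definition support_graph : fsgraph X :=
  FSGraph support_adj_irr support_adj_sym support_adj_vertices.

End SupportGraph.

Section Lambda.
Variables (R : realType) (d : Order.disp_t) (X : orderType d).

(* The sign [t : e], for #|` t| = 3 and #|` e| = 2; [sort] lists the elements
   a < b < c of t, and the last branch is only reached when #|` t| <> 3. *)
Definition tsign (t e : {fset X}) : int :=
  if sort <=%O t is [:: a; b; c] then
    if (e == [fset a; b]) || (e == [fset b; c]) then 1
    else if e == [fset a; c] then -1
    else 0
  else 0.

Definition delta1 (T : {fset {fset X}}) :
    'M[R]_(#|{: T}|, #|{: edges (support_graph T)}|) :=
  \matrix_(i, j) (tsign (val (enum_val i)) (val (enum_val j)))%:~R.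

Definition smallest_pos_eigenvalue (m : nat) (A : 'M[R]_m) (a : R) : Prop :=
  [/\ eigenvalue A a, 0 < a &
      forall b, eigenvalue A b -> 0 < b -> a <= b].

(* The default value 0 is returned when there is no positive eigenvalue, which
   does not happen for a nonempty set T of 3-element sets. *)
Definition lambda (T : {fset {fset X}}) : R :=
  xget 0 [set a | smallest_pos_eigenvalue ((delta1 T)^T *m delta1 T) a]%classic.

End Lambda.

(* Main.v *)
Require Import Defs.
From mathcomp Require Import spectral complex.

Import Order.TTheory GRing.Theory Num.Theory.

Local Open Scope fset_scope.
Local Open Scope ring_scope.
Local Open Scope sesquilinear_scope.

(** Fix an edge [e] lying in [k >= 1] triples and let [A] be the Gram matrix of
    [delta1 T]. Expanding the basis vector of [e] in an orthonormal eigenbasis of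
    [A] gives [lambda * A e e <= (A *m A) e e], since [lambda * b <= b ^+ 2] for
    every eigenvalue [b]. Here [A e e = k], while row [e] of [A] has, besides
    [k] on the diagonal, exactly [2 * k] nonzero entries, all of them [1] or [-1]:
    two distinct edges lie in at most one common triple. Hence
    [lambda * k <= k ^+ 2 + 2 * k], so [n <= k + 2]; the other bounds follow by
    counting. *)

(** * Spectral inequality for Gram matrices *)

Lemma unitary_diag_form (C : numClosedFieldType) (n : nat) (P : 'M[C]_n)
    (g u : 'rV[C]_n) :
  (u *m (P^t* *m diag_mx g *m P) *m u^t*) 0 0 =
    \sum_i g 0 i * `|(u *m P^t*) 0 i| ^+ 2.
Proof.
have -> : u *m (P^t* *m diag_mx g *m P) *m u^t* =
          (u *m P^t*) *m diag_mx g *m (u *m P^t*)^t*.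
  by rewrite trmx_mul map_mxM trmxCK !mulmxA.
rewrite mxE; apply: eq_bigr => i _.
by rewrite mul_mx_diag mxE [_^t* _ _]mxE [_^T _ _]mxE normCK mulrAC mulrC mulrA.
Qed.

Lemma unitary_diag_sqr (C : numClosedFieldType) (n : nat) (P : 'M[C]_n)
    (g : 'rV[C]_n) : P \is unitarymx ->
  (P^t* *m diag_mx g *m P) *m (P^t* *m diag_mx g *m P) =
    P^t* *m diag_mx (\row_i (g 0 i ^+ 2)) *m P.
Proof.
move=> P_unitary; rewrite !mulmxA mulmxtVK // -[P^t* *m _ *m diag_mx g]mulmxA.
by rewrite mulmx_diag.
Qed.

(** If [v] is an eigenvector for [b], then [b] times the squared norm of [v] equals the squared norm
    of [v *m D^T]. *)
Lemma eigenvalue_gram_ge0 (R : realFieldType) (m n : nat) (D : 'M[R]_(m, n))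
    (b : R) : eigenvalue (D^T *m D) b -> 0 <= b.
Proof.
have sqE p (w : 'rV[R]_p) : (w *m w^T) 0 0 = \sum_i w 0 i ^+ 2.
  by rewrite mxE; apply: eq_bigr => i _; rewrite mxE.
case/eigenvalueP => v vA v_neq0.
have v_gt0 : 0 < (v *m v^T) 0 0.
  rewrite sqE lt_def sumr_ge0 ?andbT => [|i _]; last exact: sqr_ge0.
  apply: contra v_neq0; rewrite psumr_eq0 => [/allP v0|i _]; last exact: sqr_ge0.
  apply/eqP/rowP => i; rewrite mxE; apply/eqP.
  by have := v0 i (mem_index_enum i); rewrite sqrf_eq0.
rewrite -(pmulr_lge0 _ v_gt0).
have -> : b * (v *m v^T) 0 0 = ((v *m D^T) *m (v *m D^T)^T) 0 0.
  by rewrite trmx_mul trmxK mulmxA -(mulmxA v) vA -scalemxAl [RHS]mxE.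
by rewrite sqE sumr_ge0 // => i _; exact: sqr_ge0.
Qed.

(** In an orthonormal eigenbasis both sides become sums weighted by the squared moduli of the
    coordinates of [u], so it suffices to compare [a * b] with [b ^+ 2] for each eigenvalue [b]. The
    diagonalization takes place over [R[i]]. *)
Lemma gram_form_gap (R : rcfType) (m n : nat) (D : 'M[R]_(m, n)) (a : R) :
  let A := D^T *m D in
  (forall b, eigenvalue A b -> 0 < b -> a <= b) ->
  forall u : 'rV[R]_n,
    a * (u *m A *m u^T) 0 0 <= (u *m (A *m A) *m u^T) 0 0.
Proof.
move=> A a_min u; pose f := real_complex R; pose AC : 'M[R[i]]_n := map_mx f A.
have A_sym : A^T = A by rewrite /A trmx_mul trmxK.
have AC_herm : AC \is hermsymmx.
  apply: realsym_hermsym.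
    by apply/is_hermitianmxP; rewrite expr0 scale1r map_mx_id // map_trmx A_sym.
  by apply/mxOverP => i j; rewrite mxE; apply/complex_realP; exists (A i j).
have [P [g [P_unitary g_real AC_eq]]] : exists (P : 'M_n) (g : 'rV_n),
    [/\ P \is unitarymx, g \is a realmx & AC = P^t* *m diag_mx g *m P].
  exists (spectralmx AC), (spectral_diag AC).
  rewrite -invmx_unitary ?spectral_unitarymx //; split=> //.
    exact: hermitian_spectral_diag_real.
  exact/orthomx_spectralP/hermitian_normalmx.
have formE (M : 'M[R]_n) :
    f ((u *m M *m u^T) 0 0) = (map_mx f u *m map_mx f M *m (map_mx f u)^t*) 0 0.
  (* The entries of [u] are real, so conjugation fixes them. *)
  have -> : (map_mx f u)^t* = map_mx f u^T.
    by apply/matrixP => i j; rewrite !mxE; apply/CrealP/complex_realP; exists (u j i).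
  by rewrite -!map_mxM [RHS]mxE.
rewrite -(lecR (a * _)) rmorphM /= -/f !formE.
have -> : map_mx f (A *m A) = AC *m AC by rewrite /AC -map_mxM.
rewrite -/AC AC_eq unitary_diag_sqr //.
rewrite !unitary_diag_form mulr_sumr ler_sum // => i _.
rewrite mulrA [(\row__ _) 0 i]mxE ler_wpM2r ?exprn_ge0 //.
have /mxOverP/(_ 0 i)/complex_realP[b g_eq] := g_real.
(* Row [i] of [P] is an eigenvector over [R[i]], nonzero since [P] is unitary; as [b] is real, being
   an eigenvalue descends to [R] along [f]. *)
have b_eig : eigenvalue A b.
  rewrite -(eigenvalue_map f) -/AC; apply/eigenvalueP.
  exists (row i P).
    rewrite AC_eq !mulmxA -[row i P *m P^t*]row_mul (unitarymxP P_unitary).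
    rewrite row1 -rowE row_diag_mx -scalemxAl -rowE.
    by rewrite g_eq.
  apply/eqP => Pi0; have := unitarymxP P_unitary.
  move=> /(congr1 (row i)); rewrite row_mul Pi0 mul0mx row1 => /rowP/(_ i)/eqP.
  by rewrite !mxE !eqxx eq_sym oner_eq0.
rewrite g_eq -rmorphXn -rmorphM /= lecR expr2.
have := eigenvalue_gram_ge0 _ _ _ _ _ b_eig.
(* A zero eigenvalue contributes nothing to either side; positive ones are at least [a]. *)
rewrite le_eqVlt => /predU1P[<-|b_gt0]; first by rewrite !mulr0.
by rewrite ler_pM2r // a_min.
Qed.

(** * Pairs inside triples, and their signs *)

Lemma pair_in_tripleP (X : choiceType) (t e : {fset X}) :
  #|` t| = 3%N -> #|` e| = 2%N -> e `<=` t -> exists2 z, z \in t & e = t `\ z.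
Proof.
move=> t3 e2 e_sub.
have /cardfs1P[z tDe] : #|` t `\` e| == 1%N by rewrite cardfsDS // t3 e2.
exists z; last by rewrite -tDe fsetDK.
by have := fset11 z; rewrite -tDe => /fsetDP[].
Qed.

(** Squaring removes the sign and with it the order on [X]: the three pairs listed by [tsign] are
    all the pairs in [t]. *)
Lemma tsign_sqr (d : Order.disp_t) (X : orderType d) (t e : {fset X}) :
  #|` t| = 3%N -> #|` e| = 2%N -> tsign t e ^+ 2 = (e `<=` t)%:R.
Proof.
move=> t3 e2; rewrite /tsign.
have := mem_sort <=%O t; have := size_sort <=%O t; have := sort_uniq <=%O t.
rewrite fset_uniq -[size t]/(#|` t|) t3.
case: sort => [|a [|b [|c [|? ?]]]] //= abc_uniq _ abcE.
have tE : t = [fset a; b; c].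
  by apply/fsetP => x; rewrite -abcE !inE orbA.
have e_sub : (e `<=` t) = [|| e == [fset a; b], e == [fset b; c] | e == [fset a; c]].
  apply/idP/idP => [e_sub|]; last first.
    by case/or3P => /eqP ->; rewrite tE !fsubUset !fsub1set !inE !eqxx ?orbT.
  have [z] := pair_in_tripleP _ _ _ t3 e2 e_sub; move: abc_uniq.
  rewrite !inE negb_or andbT => /andP[/andP[ab ac] bc] zt ->; move: zt.
  rewrite {e_sub} tE !inE -orbA => /or3P[] /eqP ->; apply/or3P.
  - apply/Or32/eqP/fsetP => x; rewrite !inE.
    case: (eqVneq x a) => [->|_] //=.
    by rewrite (negPf ab) (negPf ac).
  - apply/Or33/eqP/fsetP => x; rewrite !inE.
    case: (eqVneq x b) => [->|_] //=; last by rewrite orbF.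
    by rewrite (negPf bc) eq_sym (negPf ab).
  - apply/Or31/eqP/fsetP => x; rewrite !inE.
    case: (eqVneq x c) => [->|_] /=; last by rewrite orbF.
    by rewrite eq_sym (negPf ac) eq_sym (negPf bc).
rewrite e_sub orbA; case: orP => //= _.
by case: eqP => _; rewrite ?sqrrN ?expr0n.
Qed.

Lemma card_pairs_in_triple (X : choiceType) (E : {fset {fset X}}) (t : {fset X}) :
  #|` t| = 3%N -> (forall e, e \in E -> #|` e| = 2%N) ->
  (#|` [fset e in E | e `<=` t]| <= 3)%N.
Proof.
move=> t3 E2.
have sub : [fset e in E | e `<=` t] `<=` [fset t `\ z | z in t].
  apply/fsubsetP => e; rewrite !inE => /andP[/E2 e2 e_sub].
  have [z zt ->] := pair_in_tripleP _ _ _ t3 e2 e_sub.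
  by apply/imfsetP; exists z.
apply: leq_trans (fsubset_leq_card sub) _.
by rewrite -t3; apply: leq_trans (leq_imfset_card _ _ _) _.
Qed.

Lemma sum_indicator_fset (R : pzSemiRingType) (I : choiceType) (A : {fset I})
    (P : pred I) :
  \sum_(i <- A) (P i)%:R = #|` [fset i in A | P i]|%:R :> R.
Proof.
rewrite -natr_sum card_fset_sum1 big_fset /= [in RHS]big_mkcond.
by congr (_%:R); apply: eq_bigr => i _; case: (P i).
Qed.

Lemma sqr_sum_single (R : idomainType) (I : choiceType) (A : {fset I})
    (F : I -> R) :
  {in A &, forall i j, F i != 0 -> F j != 0 -> i = j} ->
  (\sum_(i <- A) F i) ^+ 2 = \sum_(i <- A) F i ^+ 2.
Proof.
move=> F_single; have [/hasP[i iA Fi]|] := boolP (has (fun i => F i != 0) A).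
  have F0 j : j \in A `\ i -> F j = 0.
    case/fsetD1P => ji jA; apply/eqP; apply: contraNT ji => Fj.
    by apply/eqP/F_single.
  rewrite (big_fsetD1 i) // [in RHS](big_fsetD1 i) //=.
  rewrite big_seq big1 // [in RHS]big_seq big1 ?addr0 //.
  by move=> j /F0->; rewrite expr0n.
move/hasPn => F0; rewrite big_seq big1 => [|i /F0/negPn/eqP->] //.
by rewrite expr0n big_seq big1 // => i /F0/negPn/eqP->; rewrite expr0n.
Qed.

Lemma edge_supportP (X : choiceType) (T : {fset {fset X}}) (e : {fset X}) :
  e \in edges (support_graph T) -> #|` e| = 2%N /\ exists2 t, t \in T & e `<=` t.
Proof.
case/imfset2P => x _ [y]; rewrite !inE => /andP[_ /andP[xy /existsP[t xyt]]] ->.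
split; first by rewrite cardfs2 xy.
by exists (val t); rewrite ?fsvalP // fsubUset !fsub1set.
Qed.

Lemma triple_edge (X : choiceType) (T : {fset {fset X}}) (t : {fset X}) x y :
  t \in T -> x \in t -> y \in t -> x != y -> adj (support_graph T) x y.
Proof.
move=> tT xt yt xy; rewrite /= /support_adj xy /=.
by apply/existsP; exists [` tT]; rewrite /= xt yt.
Qed.

(** The union of two distinct pairs has at least three elements, so it fills [t]. Hence two distinct
    edges share at most one triple. *)
Lemma eq_triple_of_pairs (X : choiceType) (e e' t : {fset X}) :
  #|` t| = 3%N -> #|` e| = 2%N -> #|` e'| = 2%N -> e != e' ->
  e `<=` t -> e' `<=` t -> t = e `|` e'.
Proof.
move=> t3 e2 e'2 ee' et e't; apply/eqP.
rewrite eq_sym eqEfcard fsubUset et e't t3 /= ltnNge.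
apply: contra ee' => small.
have /eqP -> : e == e `|` e' by rewrite eqEfcard fsubsetUl e2.
by rewrite eq_sym eqEfcard fsubsetUr e'2.
Qed.

(** * The row of the Gram matrix at a fixed edge *)

Section EdgeBound.

Variables (R : realType) (d : Order.disp_t) (X : orderType d).
Variables (T : {fset {fset X}}) (e0 : {fset X}).
Hypothesis T_card3 : forall t : {fset X}, t \in T -> #|` t| = 3%N.
Let E := edges (support_graph T).
Hypothesis e0E : e0 \in E.

Let s (t e : {fset X}) : R := (tsign t e)%:~R.
(** Row [e0] of the Gram matrix, indexed by edges instead of ordinals. *)
Let g (e : {fset X}) : R := \sum_(t <- T) s t e0 * s t e.
Let k := #|` [fset t in T | e0 `<=` t]|.

Let E_card2 e : e \in E -> #|` e| = 2%N. Proof. by case/edge_supportP. Qed.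

Let s_sqr t e : t \in T -> e \in E -> s t e ^+ 2 = (e `<=` t)%:R.
Proof.
move=> tT eE; rewrite -rmorphXn tsign_sqr ?(T_card3 t) ?(E_card2 e) //=.
by rewrite rmorph_nat.
Qed.

Let gram_e0 : g e0 = k%:R.
Proof.
rewrite -sum_indicator_fset /g !big_seq; apply: eq_bigr => t tT.
by rewrite -expr2 s_sqr.
Qed.

(** Only the triple that is the union of [e] and [e0] can contribute to [g e], so squaring creates
    no cross terms. *)
Let gram_sqr_off e : e \in E `\ e0 ->
  g e ^+ 2 = \sum_(t <- T) (e0 `<=` t)%:R * (e `<=` t)%:R.
Proof.
case/fsetD1P => ee0 eE; rewrite /g sqr_sum_single.
  by rewrite !big_seq; apply: eq_bigr => t tT; rewrite exprMn !s_sqr.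
have tE t : t \in T -> s t e0 * s t e != 0 -> t = e `|` e0.
  move=> tT; rewrite -sqrf_eq0 exprMn !s_sqr // -natrM pnatr_eq0 muln_eq0.
  rewrite negb_or !eqb0 !negbK => /andP[e0t et].
  by apply: eq_triple_of_pairs; rewrite ?(T_card3 t) ?(E_card2 e) ?(E_card2 e0).
by move=> t t' tT t'T /(tE t tT) -> /(tE t' t'T) ->.
Qed.

(** Off the diagonal, the count goes by triples rather than by edges: each triple containing [e0]
    contains at most two other edges. *)
Lemma gram_sqr_sum_le : \sum_(e <- E) g e ^+ 2 <= k%:R ^+ 2 + 2%:R * k%:R.
Proof.
rewrite (big_fsetD1 e0) //= gram_e0 lerD2l big_seq (eq_bigr _ gram_sqr_off).
rewrite -big_seq exchange_big /= -sum_indicator_fset mulr_sumr !big_seq.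
apply: ler_sum => t tT; rewrite -mulr_sumr mulrC.
have [e0t|] := boolP (e0 `<=` t); last by rewrite !mulr0.
(* At most three edges lie in [t] and [e0] is one of them, so the others are strictly fewer than
   three. *)
rewrite !mulr1 sum_indicator_fset ler_nat -ltnS.
apply: leq_trans (card_pairs_in_triple _ E t (T_card3 t tT) E_card2).
apply: fproper_ltn_card; rewrite fproperE; apply/andP; split.
  by apply/fsubsetP => e; rewrite !inE => /andP[/andP[_ ->] ->].
apply/negP => /fsubsetP/(_ e0); rewrite !inE eqxx e0t !andbT /=.
by move=> /(_ e0E).
Qed.

Lemma smallest_pos_eigenvalue_gram_le a :
  smallest_pos_eigenvalue ((delta1 R T)^T *m delta1 R T) a -> a <= (k + 2)%:R.
Proof.
case=> _ _ /gram_form_gap gap.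
pose j0 : 'I_#|{: E}| := enum_rank [` e0E].
have gramE j : ((delta1 R T)^T *m delta1 R T) j0 j = g (val (enum_val j)).
  rewrite mxE /g big_seq_fsetE /=.
  rewrite [RHS](reindex_onto enum_val enum_rank) /=; last by move=> *; rewrite enum_rankK.
  apply: eq_big => [i|i _]; first by rewrite enum_valK eqxx.
  by rewrite !mxE enum_rankK.
have gramE' j : ((delta1 R T)^T *m delta1 R T) j j0 = g (val (enum_val j)).
  have gram_sym : ((delta1 R T)^T *m delta1 R T)^T = (delta1 R T)^T *m delta1 R T.
    by rewrite trmx_mul trmxK.
  by rewrite -gram_sym mxE gramE.
(* At the basis vector of [e0] the two forms are the diagonal entry [k] and, by symmetry of the Gram
   matrix, the sum of squares of its row. *)
have := gap (delta_mx 0 j0); rewrite trmx_delta -!rowE -!colE.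
rewrite 2!mxE gramE enum_rankK gram_e0 2!mxE [leRHS]mxE.
have -> : \sum_j ((delta1 R T)^T *m delta1 R T) j0 j *
                 ((delta1 R T)^T *m delta1 R T) j j0 = \sum_(e <- E) g e ^+ 2.
  rewrite big_seq_fsetE /= [RHS](reindex_onto enum_val enum_rank) /=; last first.
    by move=> *; rewrite enum_rankK.
  apply: eq_big => [i|i _]; first by rewrite enum_valK eqxx.
  by rewrite gramE gramE' expr2.
move=> /le_trans/(_ gram_sqr_sum_le).
(* The factor [k] cancels: it is positive because an edge of the support graph lies in some
   triple. *)
rewrite expr2 -mulrDl -natrD ler_pM2r // ltr0n cardfs_gt0.
have [_ [t tT e0t]] := edge_supportP _ _ _ e0E.
by apply/fset0Pn; exists t; rewrite !inE tT.
Qed.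

End EdgeBound.

(** * Counting neighbours, and the theorem *)

Lemma in_neighborhood (X : choiceType) (G : fsgraph X) (x y : X) :
  (y \in neighborhood G x) = (y \in vertices G) && adj G x y.
Proof. by rewrite !inE. Qed.

(** The third vertex of a triple through [x] and [y] is a common neighbour, and it determines the
    triple. *)
Lemma card_supersets_le_common_neighbors (X : choiceType) (T : {fset {fset X}})
    (x y : X) :
  (forall t : {fset X}, t \in T -> #|` t| = 3%N) -> x != y ->
  (#|` [fset t in T | [fset x; y] `<=` t]| <=
   #|` neighborhood (support_graph T) x `&` neighborhood (support_graph T) y|)%N.
Proof.
move=> T3 xy; set N := _ `&` _.
have sub : [fset t in T | [fset x; y] `<=` t] `<=`
           [fset z |` [fset x; y] | z in N].
  apply/fsubsetP => t; rewrite !inE => /andP[tT xyt].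
  have xy2 : #|` [fset x; y]| = 2%N by rewrite cardfs2 xy.
  have [z zt xyE] := pair_in_tripleP _ _ _ (T3 t tT) xy2 xyt.
  have : z \notin [fset x; y] by rewrite xyE !inE eqxx.
  rewrite !inE negb_or ![z == _]eq_sym => /andP[xz yz].
  move: xyt; rewrite fsubUset !fsub1set => /andP[xt yt].
  apply/imfsetP; exists z; last by rewrite xyE fsetD1K.
  have xz_adj := triple_edge _ _ _ _ _ tT xt zt xz.
  have yz_adj := triple_edge _ _ _ _ _ tT yt zt yz.
  have zV : z \in vertices (support_graph T).
    by rewrite adj_sym in xz_adj; exact: adj_vertices xz_adj.
  by rewrite in_fsetI !in_neighborhood zV xz_adj yz_adj.
apply: leq_trans (fsubset_leq_card sub) _.
by apply: leq_trans (leq_imfset_card _ _ _) _.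
Qed.

Theorem theorem3p2 (R : realType) (d : Order.disp_t) (X : orderType d)
    (T : {fset {fset X}}) (n : nat)
    (T_nonempty : T != fset0)
    (T_card3 : forall t : {fset X}, t \in T -> #|` t| = 3%N)
    (n_gt0 : (0 < n)%N)
    (n_le : n%:Z <= Num.ceil (lambda R T)) :
  let G := support_graph T in
  [/\ forall e : {fset X}, e \in edges G ->
        (n - 2 <= #|` [fset t in T | e `<=` t]|)%N,
      forall x y : X, [fset x; y] \in edges G ->
        (n - 2 <= #|` neighborhood G x `&` neighborhood G y|)%N,
      forall x : X, x \in vertices G ->
        (n - 2 <= #|` [fset t in T | x \in t]|)%N /\ (n - 1 <= degree G x)%N
    & (n - 1 <= min_degree G)%N /\ (n <= #|` vertices G|)%N].

Proof.
move=> G.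
(* Without a smallest positive eigenvalue, [lambda] would be its default 0, whose ceiling is less
   than [n]. *)
have lam : smallest_pos_eigenvalue ((delta1 R T)^T *m delta1 R T) (lambda R T).
  move: n_le; rewrite /lambda; case: xgetP => [a _ //|_].
  by rewrite ceil0 lez_nat leqNgt n_gt0.
have n_le_edge e : e \in edges G -> (n - 2 <= #|` [fset t in T | e `<=` t]|)%N.
  move=> eE; rewrite leq_subLR addnC -lez_nat.
  (* An integer bounding [lambda] from above also bounds its ceiling. *)
  apply: le_trans n_le _; rewrite ceil_le_int.
  exact: smallest_pos_eigenvalue_gram_le lam.
have n_le_common x y : [fset x; y] \in edges G ->
    (n - 2 <= #|` neighborhood G x `&` neighborhood G y|)%N.
  move=> xyE; apply: leq_trans (n_le_edge _ xyE) _.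
  apply: card_supersets_le_common_neighbors => //.
  by have [+ _] := edge_supportP _ _ _ xyE; rewrite cardfs2; case: eqP.
have n_le_vertex x : x \in vertices G ->
    (n - 2 <= #|` [fset t in T | x \in t]|)%N /\ (n - 1 <= degree G x)%N.
  case/bigfcupP => t; rewrite andbT => tT xt.
  have /fset0Pn[y /fsetD1P[yx yt]] : t `\ x != fset0.
    have := T_card3 t tT; rewrite (cardfsD1 x) xt add1n => -[tx2].
    by rewrite -cardfs_gt0 tx2.
  have xy_adj : adj G x y by apply: triple_edge tT xt yt _; rewrite eq_sym.
  have yV : y \in vertices G by rewrite adj_sym in xy_adj; exact: adj_vertices xy_adj.
  have xyE : [fset x; y] \in edges G.
    apply/imfset2P; exists x; first exact: adj_vertices xy_adj.
    by exists y => //; rewrite !inE yV.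
  split.
    apply: leq_trans (n_le_edge _ xyE) _; apply: fsubset_leq_card.
    by apply/fsubsetP => t'; rewrite !inE fsubUset !fsub1set => /and3P[-> ->].
  have yN : y \in neighborhood G x by rewrite in_neighborhood yV.
  (* The neighbour [y] of [x] is not adjacent to itself, so it adds one to the common neighbours of
     [x] and [y]. *)
  rewrite /degree (cardfsD1 y) yN leq_subLR addnA -leq_subLR.
  apply: leq_trans (n_le_common _ _ xyE) _; apply: fsubset_leq_card.
  apply/fsubsetP => z; rewrite in_fsetI in_fsetD1 => /andP[-> /=].
  rewrite in_neighborhood andbT => /andP[_].
  by apply: contraTneq => ->; rewrite adj_irr.
have [t tT] : exists t, t \in T by apply/fset0Pn.
have /fset0Pn[x xt] : t != fset0 by rewrite -cardfs_gt0 T_card3.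
have xV : x \in vertices G by apply/bigfcupP; exists t; rewrite ?tT.
have n_le_V : (n <= #|` vertices G|)%N.
  have [_ deg_x] := n_le_vertex x xV.
  rewrite (cardfsD1 x) xV -leq_subLR; apply: leq_trans deg_x _.
  apply: fsubset_leq_card; apply/fsubsetP => y.
  rewrite in_neighborhood in_fsetD1 => /andP[-> xy].
  by rewrite andbT; apply: contraTneq xy => ->; rewrite adj_irr.
split=> //; split=> //; rewrite /min_degree big_seq.
(* The neutral element of the minimum is the number of vertices, so the base case follows from
   [n_le_V]. *)
elim/big_ind: _ => [|i j ni nj|y yV].
- exact: leq_trans (leq_subr _ _) n_le_V.
- by rewrite leq_min ni nj.
- by case: (n_le_vertex y yV).
Qed.
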